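(* Let $\{f_{i,j}\}_{(i,j)\in\mathbb{N}^2}$ be a two-parameter system of functions that is orthonormal on a metric space $\mathbb{X}$ equipped with a Radon measure $\mu$, and let the numerical sequence $\{c_{i,j}\}_{(i,j)\in\mathbb{N}^2}$ satisfy $$\sum_{(i,j)\in\mathbb{N}^2} |(i,j)|^{\frac{\ln(2+\sqrt{3})}{\ln(2)}}\,|c_{i,j}|^2<+\infty .$$ Consider a sequence of right triangles $\{Tri_{a_k,b_k}\}_{k\in\mathbb{N}}$ whose eccentricity $\gamma$ is bounded, that is, $$1\le \sup_{k\in\mathbb{N}}\max\left(\frac{a_k}{b_k},\frac{b_k}{a_k}\right)=\gamma<+\infty .$$ Then the limit $$\lim_{k\to+\infty}\ \sum_{(i,j)\in Tri_{a_k,b_k}} c_{i,j}f_{i,j}(x),$$ corresponding to the grouping of the functional series $\sum_{(i,j)\in\mathbb{N}^2}c_{i,j}f_{i,j}(x)$ by the triangles $Tri_{a_k,b_k}$, exists and is finite almost everywhere on $\mathbb{X}$.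
   Context: A system $\{f_{i,j}\}_{(i,j)\in\mathbb{N}^2}$ of functions $f_{i,j}:\mathbb{X}\to\mathbb{R}$ is orthonormal on the metric space $\mathbb{X}$ equipped with the Radon measure $\mu$ if $\int_{\mathbb{X}} f_{i,j}f_{i',j'}\,d\mu=1$ when $(i,j)=(i',j')$ and $\int_{\mathbb{X}} f_{i,j}f_{i',j'}\,d\mu=0$ when $(i,j)\ne(i',j')$. Almost everywhere is with respect to $\mu$. For $0\le a,b<+\infty$, $Tri_{a,b}$ denotes the right triangle in the plane with vertices $(0,0)$, $(a,0)$, $(0,b)$. Sums over $(i,j)\in Tri_{a,b}$ run over the index pairs $(i,j)\in\mathbb{N}^2$ lying in $Tri_{a,b}$. $|(i,j)|=\sqrt{i^2+j^2}$ is the Euclidean norm.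
   Formalization: The triangles are also assumed to group the series: each index (i,j) is eventually always in, or eventually always out of, Tri_{a_k,b_k} (true if they exhaust the quadrant or are nested); else alternating Tri_{1/2,1/2}, Tri_{1,1} with only c_{1,0} nonzero fails. Sides are taken positive. *)

(* Defs.v *)
From HB Require Import structures.
From mathcomp Require Import all_boot all_order all_algebra.
From mathcomp Require Import all_classical all_reals all_analysis.

Set Implicit Arguments.
Unset Strict Implicit.
Unset Printing Implicit Defensive.

Import Order.TTheory GRing.Theory Num.Theory.
Import numFieldNormedType.Exports.

Local Open Scope classical_set_scope.
Local Open Scope ring_scope.

(* The library builds generated sigma-algebras on pointed types only. The base
   point costs nothing here: a space carrying an orthonormal system is nonempty. *)
#[short(type="pmetricType")]
HB.structure Definition PointedMetric (K : numDomainType) :=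
  { M of Metric K M & Pointed M }.

Definition borel (R : realType) (X : pmetricType R) :=
  g_sigma_algebraType (@open X).

(* Radon measure on a metric space that need not be locally compact: a locally
   finite Borel measure which is inner regular with respect to compact sets. *)
Definition radon (R : realType) (X : pmetricType R)
    (mu : {measure set (borel X) -> \bar R}) : Prop :=
  (forall x : X, exists2 U : set X, open_nbhs x U & (mu U < +oo)%E) /\
  (forall A : set (borel X), measurable A ->
     mu A = ereal_sup [set mu K | K in [set K : set X | compact K /\ K `<=` A]]).

Definition orthonormal_system (R : realType) (X : pmetricType R)
    (mu : {measure set (borel X) -> \bar R})
    (f : nat * nat -> borel X -> R) : Prop :=
  (forall p, measurable_fun setT (f p)) /\
  (forall p q, (\int[mu]_(x in setT) (f p x * f q x)%:E =
                (if p == q then 1 else 0))%E).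

Definition Enorm (R : realType) (p : nat * nat) : R :=
  Num.sqrt (p.1%:R ^+ 2 + p.2%:R ^+ 2).

(* Convex combinations of the vertices (0, 0), (a, 0) and (0, b). *)
Definition Tri (R : realType) (a b : R) : set (R * R) :=
  [set z | exists s t : R,
     [/\ 0 <= s, 0 <= t, s + t <= 1 & z = (s * a, t * b)]].

Definition Tri_index (R : realType) (a b : R) : set (nat * nat) :=
  [set p | Tri a b (p.1%:R, p.2%:R)].

Definition eccentricity (R : realType) (a b : nat -> R) : \bar R :=
  ereal_sup (range (fun k => (Num.max (a k / b k) (b k / a k))%:E)).

(* A sequence of triangles groups the double series when every term is
   eventually kept or eventually left out. This holds if the triangles exhaust
   the quadrant, and also if they are nested. Without it no limit can be
   expected: take a single nonzero coefficient and let the triangles gain and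
   lose its index infinitely often. *)
Definition grouping (R : realType) (a b : nat -> R) : Prop :=
  forall p : nat * nat,
    (\forall k \near \oo, Tri_index (a k) (b k) p) \/
    (\forall k \near \oo, ~ Tri_index (a k) (b k) p).

(* [Tri_index a b] is a finite set when [a] and [b] are nonnegative. *)
Definition Tri_sum (R : realType) (T : Type) (c : nat * nat -> R)
    (f : nat * nat -> T -> R) (a b : R) (x : T) : R :=
  \sum_(p \in Tri_index a b) c p * f p x.

(* Main.v *)
Require Import Defs.
From mathcomp Require Import all_boot all_order all_algebra.
From mathcomp Require Import all_classical all_reals all_analysis.
From mathcomp Require Import measurable_realfun.
From mathcomp Require Import ring lra zify.

Import Order.TTheory GRing.Theory Num.Theory.
Import numFieldNormedType.Exports.

Local Open Scope classical_set_scope.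
Local Open Scope ring_scope.

Set Implicit Arguments.
Unset Strict Implicit.

(** The index quadrant is cut into cells (i, n), the cell (i, n) being the piece
    n ^ 2 <= j < (n + 1) ^ 2 of the column i. A triangle meets each column in an
    initial segment, so in each column it cuts at most one cell; every other
    cell lies inside the triangle or outside it. With v = c * f, write Delta for
    the sum of v over a cell and B for the sum of |v| over it. The sum of v over
    the triangle is a sum of Delta over the full cells plus, in each column, one
    error of size at most B.

    Let u i = (i + 1) ^ (5/4), so that the sum of the 1 / u i converges. Since
    |Delta| <= 1 / (u i * u n) + u i * u n * Delta ^ 2 and, for every eps > 0,
    B <= eps / u i + u i * B ^ 2 / eps, both contributions have uniformly small
    tails at every point where the two series of terms u i * u n * Delta ^ 2 and
    u i * B ^ 2 converge; here it is essential that eps / u i is summed only once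
    per column. As every index is eventually kept or eventually left out, the
    finitely many remaining terms are eventually constant, and the sums over the
    triangles form a Cauchy sequence ([cvg_planar_grouping]).

    The two series converge almost everywhere because they have a finite
    integral ([ae_bounded_sqsum]): by orthonormality the integral of Delta ^ 2 is
    the sum of c ^ 2 over the cell, and by the Cauchy-Schwarz inequality that of
    B ^ 2 is at most 2 n + 1 <= 2 * u n times this sum. So all that is needed is
    that u i * u n * c ^ 2 be summable. As n <= sqrt j, away from the origin
    u i * u n is at most a constant times |(i, j)| ^ (5/4 + 5/8)
    ([cell_weight_le]), and 5/4 + 5/8 = 15/8 <= ln (2 + sqrt 3) / ln 2
    ([exponent_ge]). *)

(** * Cells and square partial sums *)

(** The blocks are delimited by squares to balance two losses. Longer blocks make
    the absolute sum over a cut block expensive, shorter ones make the full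
    blocks too numerous; with block lengths of the order of sqrt j each costs
    about sqrt j. *)
Definition square_block (n : nat) : seq nat := index_iota (n ^ 2) (n.+1 ^ 2).

Lemma sum_square_block (V : nmodType) (g : nat -> V) (L : nat) :
  \sum_(0 <= n < L) \sum_(j <- square_block n) g j =
  \sum_(0 <= j < L ^ 2) g j.
Proof.
elim: L => [|L IHL]; first by rewrite !big_geq.
rewrite big_nat_recr//= IHL -big_cat_nat//=.
by rewrite leq_sqr.
Qed.

(** Both indices are cut at the same bound, so that the tails of a double series
    are differences of a single sequence. *)
Definition sqsum (V : nmodType) (g : nat -> nat -> V) (L : nat) : V :=
  \sum_(0 <= i < L) \sum_(0 <= n < L) g i n.

Lemma sqsumB (V : zmodType) (g : nat -> nat -> V) (N L : nat) : (N <= L)%N ->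
  sqsum g L - sqsum g N =
  sqsum (fun i n => if (i < N)%N && (n < N)%N then 0 else g i n) L.
Proof.
move=> NL; rewrite /sqsum (big_nat_widen 0 N L)// [X in _ - X]big_mkcond/= -sumrB.
apply: eq_bigr => i _; case: ifPn => iN; last first.
  by rewrite subr0; apply: eq_bigr.
rewrite (big_nat_widen 0 N L)// [X in _ - X]big_mkcond/= -sumrB.
by apply: eq_bigr => n _; case: ifPn; rewrite ?subrr ?subr0.
Qed.

Lemma ler_sqsum (R : numDomainType) (g h : nat -> nat -> R) L :
  (forall i n, g i n <= h i n) -> sqsum g L <= sqsum h L.
Proof. by move=> gh; apply: ler_sum => i _; apply: ler_sum. Qed.

Lemma ler_norm_sqsum (R : numDomainType) (g : nat -> nat -> R) L :
  `|sqsum g L| <= sqsum (fun i n => `|g i n|) L.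
Proof.
apply: (le_trans (ler_norm_sum _ _ _)); apply: ler_sum => i _.
exact: ler_norm_sum.
Qed.

Lemma sqsum_tail (R : numDomainType) (g h : nat -> nat -> R) (N L : nat) :
  (N <= L)%N -> (forall i n, `|g i n| <= h i n) ->
  `|sqsum g L - sqsum g N| <= sqsum h L - sqsum h N.
Proof.
move=> NL gh; rewrite !sqsumB//; apply: (le_trans (ler_norm_sqsum _ _)).
by apply: ler_sqsum => i n; case: ifPn; rewrite ?normr0.
Qed.

Lemma sqsum_nondecreasing (R : numDomainType) (h : nat -> nat -> R) :
  (forall i n, 0 <= h i n) ->
  {homo sqsum h : N L / (N <= L)%N >-> N <= L}.
Proof.
move=> h0 N L NL; rewrite -subr_ge0 sqsumB//.
by do 2 (apply: sumr_ge0 => ? _); case: ifP.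
Qed.

Lemma bounded_sqsum_tail (R : realType) (h : nat -> nat -> R) (C e : R) :
  (forall i n, 0 <= h i n) -> (forall L, sqsum h L <= C) -> 0 < e ->
  exists N, forall K L, (N <= K)%N -> sqsum h L - sqsum h K <= e.
Proof.
move=> h0 hC e0.
have nd := sqsum_nondecreasing h0.
have cv : cvgn (sqsum h).
  by apply: nondecreasing_is_cvgn => //; exists C => _ [L _ <-].
have /cvgrPdist_lt/(_ _ e0)[N _ HN] := cv.
exists N => K L NK.
have := HN K NK; have := nondecreasing_cvgn_le nd cv L.
rewrite /= => h1 h2; have := ler_norm (limn (sqsum h) - sqsum h K).
by lra.
Qed.

Definition square_cells (L : nat) : seq (nat * nat) :=
  [seq (i, j) | i <- index_iota 0 L, j <- index_iota 0 (L ^ 2)].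

Lemma fsbig_square_cells (V : nmodType) (g : nat * nat -> V) (L : nat) :
  \sum_(p \in [set` square_cells L]) g p =
  sqsum (fun i n => \sum_(j <- square_block n) g (i, j)) L.
Proof.
rewrite -fsbig_seq; last first.
  by apply: allpairs_uniq; rewrite ?iota_uniq// => -[? ?] [].
rewrite big_allpairs /sqsum; apply: eq_bigr => i _.
by rewrite -sum_square_block.
Qed.

(** * Summation over sets with initial segments as columns *)

Section planar_grouping.
Context {R : realType}.
Implicit Types (D : set (nat * nat)) (v : nat * nat -> R).

Definition cell_sum v D i n : R :=
  \sum_(j <- square_block n | (i, j) \in D) v (i, j).

Lemma fsbig_cell_sum v D L :
  (forall i j, D (i, j) -> (i < L)%N /\ (j < L)%N) ->
  \sum_(p \in D) v p = sqsum (cell_sum v D) L.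
Proof.
move=> DL.
transitivity (\sum_(p \in D) (if p \in D then v p else 0)).
  by apply: eq_fsbigr => p ->.
rewrite (fsbig_widen D [set` square_cells L]); last 2 first.
- move=> [i j] /DL[iL jL] /=; apply/allpairsP; exists (i, j).
  rewrite !mem_index_iota/=; split => //.
  by rewrite (leq_trans jL)// -mulnn leq_pmull// (leq_trans _ jL).
- by move=> p [_ Dp] /=; rewrite memNset.
rewrite fsbig_square_cells; apply: eq_bigr => i _; apply: eq_bigr => n _.
by rewrite /cell_sum [RHS]big_mkcond.
Qed.

Definition cut_cell D i n : bool :=
  has (fun j => (i, j) \in D) (square_block n) &&
  ~~ all (fun j => (i, j) \in D) (square_block n).

(** If the later of two cells of a column meets [D], then the earlier one lies
    entirely in [D]. *)
Lemma cut_cell_uniq D i L :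
  (forall j j', (j' <= j)%N -> D (i, j) -> D (i, j')) ->
  (\sum_(0 <= n < L) (cut_cell D i n : nat) <= 1)%N.
Proof.
move=> dn.
have cut_inj n m : cut_cell D i n -> cut_cell D i m -> (m <= n)%N.
  move=> /andP[_ /allPn[j jn /negP Dj]] /andP[/hasP[j' jm Dj'] _].
  rewrite leqNgt; apply/negP => nm; apply: Dj.
  rewrite inE; apply: (dn j'); last by move: Dj'; rewrite inE.
  move: jn jm; rewrite !mem_index_iota => /andP[_ jn] /andP[mj _].
  by rewrite (leq_trans (ltnW jn))// (leq_trans _ mj)// leq_sqr.
rewrite big_mkord.
under eq_bigr do rewrite -[nat_of_bool _]/(if _ then 1 else 0)%N.
rewrite -big_mkcond/= sum1_card; apply/card_le1_eqP => n m cn cm.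
by apply/val_inj/eqP; rewrite eqn_leq !cut_inj.
Qed.

(** In a cut cell nothing better than the absolute sum B is available; it enters
    through B <= 1 / y + y * B ^ 2, where the free parameter [y] makes the linear
    cost of a cut as small as desired. *)
Lemma ler_norm_cell_sum v D i n (y : R) : 0 < y ->
  `|cell_sum v D i n| <= `|\sum_(j <- square_block n) v (i, j)| +
   (cut_cell D i n)%:R *
     (y^-1 + y * (\sum_(j <- square_block n) `|v (i, j)|) ^+ 2).
Proof.
move=> y0; rewrite /cell_sum /cut_cell.
have [h|/hasPn h] /= := boolP (has _ _); last first.
  rewrite mul0r addr0 big_seq_cond big1 ?normr0//.
  by move=> j /andP[/h/negPf->].
have [/allP a|_] /= := boolP (all _ _).
  rewrite mul0r addr0 big_seq_cond.
  under eq_bigl => j.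
    have -> : (j \in square_block n) && ((i, j) \in D) = (j \in square_block n).
      by apply/andb_idr => /a.
    over.
  by rewrite -big_seq.
rewrite mul1r; set B := \sum_(j <- _) `|_|.
apply: (@le_trans _ _ B).
  apply: (le_trans (ler_norm_sum _ _ _)); rewrite big_mkcond/=.
  by apply: ler_sum => j _; case: ifP.
rewrite (@le_trans _ _ (y^-1 + y * B ^+ 2)) ?lerDr//.
rewrite -(ler_pM2l y0) mulrDr divff ?gt_eqF//.
have := sqr_ge0 (y * B - 1); have := sqr_ge0 (y * B); nra.
Qed.

Lemma eventually_const_sum (I : Type) (s : seq I) (g : nat -> I -> R) :
  (forall i, exists l, \forall k \near \oo, g k i = l) ->
  exists l, \forall k \near \oo, \sum_(i <- s) g k i = l.
Proof.
move=> gl; elim: s => [|i s [l hl]].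
  by exists 0; near=> k; rewrite big_nil.
have [l' hl'] := gl i; exists (l' + l).
by near=> k; rewrite big_cons; congr (_ + _); near: k.
Unshelve. all: by end_near. Qed.

(** The pointwise convergence criterion. Beyond a large square the cells contribute
    at most the tail of the first series, plus d * U for the cuts (one per
    column), plus the tail of the second series divided by d: first d is chosen,
    then the square. Inside the square the sums are eventually constant. *)
Lemma cvg_planar_grouping v (D : nat -> set (nat * nat)) (u : nat -> R) (U C1 C2 : R) :
  (forall i, 0 < u i) ->
  (forall k i j j', (j' <= j)%N -> D k (i, j) -> D k (i, j')) ->
  (forall k, exists L, forall i j, D k (i, j) -> (i < L)%N /\ (j < L)%N) ->
  (forall p, (\forall k \near \oo, D k p) \/ (\forall k \near \oo, ~ D k p)) ->
  (forall L, \sum_(0 <= i < L) (u i)^-1 <= U) ->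
  (forall L, sqsum (fun i n => `|\sum_(j <- square_block n) v (i, j)|) L <= C1) ->
  (forall L, sqsum (fun i n =>
     u i * (\sum_(j <- square_block n) `|v (i, j)|) ^+ 2) L <= C2) ->
  cvgn (fun k => \sum_(p \in D k) v p).
Proof.
move=> u0 dn bd gr hU; set g1 := fun i n => `|_|; set g2 := fun i n => _ * _.
move=> h1 h2.
have g10 i n : 0 <= g1 i n by rewrite normr_ge0.
have g20 i n : 0 <= g2 i n by rewrite mulr_ge0 ?sqr_ge0 ?ltW.
have U0 : 0 <= U by have := hU 0; rewrite big_geq.
apply/cauchy_cvgP/cauchy_exP => e e0.
pose d := e / (4 * (U + 1)).
have d0 : 0 < d by rewrite divr_gt0//; lra.
have dU : d * U <= e / 4.
  have -> : e / 4 = d * (U + 1) by rewrite /d; field; lra.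
  by rewrite ler_pM2l//; lra.
have [|N1 HN1] := bounded_sqsum_tail (e := e / 4) g10 h1; first lra.
have [|N2 HN2] := bounded_sqsum_tail (e := d * (e / 8)) g20 h2.
  by rewrite mulr_gt0//; lra.
pose N := maxn N1 N2.
have [l hl] : exists l, \forall k \near \oo, sqsum (cell_sum v (D k)) N = l.
  apply: eventually_const_sum => i.
  apply: eventually_const_sum => n.
  rewrite /cell_sum.
  under eq_exists do under eq_near do rewrite big_mkcond/=.
  apply: eventually_const_sum => j.
  case: (gr (i, j)) => h; [exists (v (i, j))|exists 0]; near=> k.
    by rewrite mem_set//; near: k.
  by rewrite memNset//; near: k.
exists l.
suff : \forall k \near \oo, ball l e (\sum_(p \in D k) v p) by [].
near=> k.
have [L HL] := bd k.
pose M := maxn N L.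
have hM i j : D k (i, j) -> (i < M)%N /\ (j < M)%N.
  by move=> /HL[? ?]; rewrite !leq_max; split; apply/orP; right.
rewrite /= /ball/= (fsbig_cell_sum v hM).
have <- : sqsum (cell_sum v (D k)) N = l by near: k.
have NM : (N <= M)%N by rewrite leq_maxl.
pose g3 i n := (cut_cell (D k) i n)%:R / u i.
(* [ler_norm_cell_sum] with [y = u i / d] *)
pose h i n := g1 i n + d * g3 i n + d^-1 * g2 i n.
have tau_h i n : `|cell_sum v (D k) i n| <= h i n.
  have du : 0 < u i / d by rewrite divr_gt0.
  apply: (le_trans (ler_norm_cell_sum _ _ _ _ du)).
  rewrite /h -addrA lerD2l /g3 invfM invrK.
  have := g20 i n; rewrite /g2 => g20in.
  case: cut_cell; rewrite ?mul0r ?mul1r.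
    by rewrite le_eqVlt; apply/orP; left; apply/eqP; ring.
  by rewrite mulr0 add0r mulr_ge0// invr_ge0 ltW.
have sqh K : sqsum h K = sqsum g1 K + d * sqsum g3 K + d^-1 * sqsum g2 K.
  rewrite /sqsum !mulr_sumr -!big_split; apply: eq_bigr => i _.
  by rewrite !mulr_sumr -!big_split.
have g3U : sqsum g3 M - sqsum g3 N <= U.
  have g30 i n : 0 <= g3 i n by rewrite mulr_ge0// invr_ge0 ltW.
  have : 0 <= sqsum g3 N by do 2 (apply: sumr_ge0 => ? _).
  suff : sqsum g3 M <= U by lra.
  apply: le_trans (hU M); apply: ler_sum => i _.
  rewrite -mulr_suml -[leRHS]mul1r ler_pM2r ?invr_gt0//.
  by rewrite -natr_sum (ler_nat _ _ 1) cut_cell_uniq//; exact: dn.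
have t1 := HN1 N M (leq_maxl _ _).
have t2 : d^-1 * (sqsum g2 M - sqsum g2 N) <= e / 8.
  by rewrite mulrC ler_pdivrMr// [leRHS]mulrC; rewrite HN2// leq_maxr.
have t3 : d * (sqsum g3 M - sqsum g3 N) <= e / 4.
  by apply: le_trans dU; rewrite ler_pM2l.
rewrite distrC; apply: (le_lt_trans (sqsum_tail NM tau_h)).
by rewrite !sqh; lra.
Unshelve. all: by end_near. Qed.

End planar_grouping.

(** * The weights *)

Section column_weights.
Context {R : realType}.

Definition column_weight (i : nat) : R := i.+1%:R `^ (5 / 4).

Lemma column_weight_gt0 i : 0 < column_weight i.
Proof. by rewrite powR_gt0. Qed.

Lemma column_weight_ge i : i.+1%:R <= column_weight i.
Proof. by rewrite le1r_powR ?ler1n//; lra. Qed.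

(** With s = (L + 1) ^ (1/4) and t = (L + 2) ^ (1/4) one has t ^ 4 - s ^ 4 = 1, hence
    1 / t ^ 5 <= 4 * (1 / s - 1 / t), and the sum telescopes. *)
Lemma sum_inv_column_weight L : \sum_(0 <= i < L) (column_weight i)^-1 <= 5.
Proof.
case: L => [|L]; first by rewrite big_geq.
apply: (@le_trans _ _ (5 - 4 * (L.+1%:R `^ 4^-1)^-1)); last first.
  by rewrite gerBl mulr_ge0// invr_ge0 powR_ge0.
elim: L => [|L IHL].
  by rewrite big_nat1 /column_weight !powR1 invr1; lra.
rewrite big_nat_recr//=.
apply: (le_trans (lerD IHL (lexx _))).
have quart k : (k.+1%:R `^ 4^-1) ^+ 4 = k.+1%:R :> R.
  by rewrite -powR_mulrn ?powR_ge0// -powRrM mulVf ?powRr1.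
have wq : column_weight L.+1 = (L.+2%:R `^ 4^-1) ^+ 5.
  by rewrite -powR_mulrn ?powR_ge0// -powRrM mulrC.
set s := L.+1%:R `^ 4^-1; set t := L.+2%:R `^ 4^-1.
have s0 : 0 < s by rewrite powR_gt0.
have st : s <= t by rewrite ge0_ler_powR ?invr_ge0 ?nnegrE ?ler_nat.
have t0 : 0 < t by apply: lt_le_trans st.
have ts : t ^+ 4 - s ^+ 4 = 1.
  rewrite /s /t !quart -natrB ?leqnSn//.
  by rewrite subSnn.
rewrite wq -/t.
suff : (t ^+ 5)^-1 <= 4 * (s^-1 - t^-1) by lra.
have -> : s^-1 - t^-1 = (s * t * (t + s) * (t ^+ 2 + s ^+ 2))^-1.
  transitivity ((t ^+ 4 - s ^+ 4) / (s * t * (t + s) * (t ^+ 2 + s ^+ 2))).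
    field; rewrite !gt_eqF//= ?addr_gt0// ?exprn_gt0//.
  by rewrite ts mul1r.
have P0 : 0 < s * t * (t + s) * (t ^+ 2 + s ^+ 2).
  by rewrite !mulr_gt0 ?addr_gt0 ?exprn_gt0.
rewrite ler_pdivlMr//.
rewrite ler_pdivrMl ?exprn_gt0//.
have -> : t ^+ 5 * 4 = t * t * (t + t) * (t ^+ 2 + t ^+ 2) by ring.
rewrite ler_pM ?mulr_ge0 ?addr_ge0 ?sqr_ge0 ?(ltW s0) ?(ltW t0)//.
  rewrite ler_pM ?mulr_ge0 ?addr_ge0 ?sqr_ge0 ?(ltW s0) ?(ltW t0)//.
    by rewrite ler_pM2r.
  by rewrite lerD2l.
by rewrite lerD2l lerXn2r ?nnegrE ?(ltW s0) ?(ltW t0).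
Qed.

(** Equivalent to 2 ^ 15 <= (2 + sqrt 3) ^ 8; the right-hand side is about 37634. *)
Lemma exponent_ge : 15 / 8 <= ln (2 + Num.sqrt 3) / ln 2 :> R.
Proof.
have l2 : 0 < ln 2 :> R by rewrite ln_gt0// ltr1n.
have s3 : 17 / 10 <= Num.sqrt 3 :> R.
  rewrite -[leLHS]ger0_norm; last lra.
  by rewrite -sqrtr_sqr ler_wsqrtr//; lra.
set r := 2 + Num.sqrt 3.
have r0 : 37 / 10 <= r by rewrite /r; lra.
have rp : 0 < r by lra.
rewrite ler_pdivlMr//.
suff : ln 2 *+ 15 <= ln r *+ 8 by rewrite -[_ *+ 15]mulr_natl -[_ *+ 8]mulr_natl; lra.
rewrite -!lnXn//; rewrite ler_ln ?posrE ?exprn_gt0//.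
have r2 : 13 <= r ^+ 2 by nra.
have r4 : 182 <= r ^+ 4.
  have -> : r ^+ 4 = r ^+ 2 * r ^+ 2 by ring.
  have : 1369 / 100 <= r ^+ 2 by nra.
  nra.
have -> : r ^+ 8 = r ^+ 4 * r ^+ 4 by ring.
have -> : 2 ^+ 15 = 128 * 256 :> R by ring.
by apply: (@le_trans _ _ (182 * 182)); [lra | rewrite ler_pM].
Qed.

Lemma Enorm_ge p : p.1%:R <= Enorm R p /\ p.2%:R <= Enorm R p.
Proof.
split; rewrite -[leLHS]ger0_norm// -sqrtr_sqr ler_wsqrtr//.
  by rewrite lerDl sqr_ge0.
by rewrite lerDr sqr_ge0.
Qed.

Definition cell_weight (i n : nat) : R := column_weight i * column_weight n.

(** With E = |(i, j)| >= 1 one has i + 1 <= 2 E and n + 1 <= 2 sqrt E, hence the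
    weight is at most (4 * E ^ (3/2)) ^ (5/4), and 4 ^ (5/4) <= 4 ^ 2. The origin
    is excluded because its norm is 0. *)
Lemma cell_weight_le (theta : R) i j n : 15 / 8 <= theta ->
  j \in square_block n -> (i, j) != (0, 0)%N ->
  cell_weight i n <= 16 * Enorm R (i, j) `^ theta.
Proof.
move=> th jn ij0; have [/= iE jE] := Enorm_ge (i, j).
set E := Enorm R (i, j) in iE jE *.
have E1 : 1 <= E.
  move: ij0; rewrite xpair_eqE negb_and -!lt0n => /orP[] h.
    by rewrite (le_trans _ iE)// ler1n.
  by rewrite (le_trans _ jE)// ler1n.
have E0 : 0 <= E by lra.
have n2 : n%:R <= E `^ 2^-1.
  rewrite powR12_sqrt// -[leLHS]ger0_norm// -sqrtr_sqr ler_wsqrtr//.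
  rewrite (le_trans _ jE)// -natrX ler_nat.
  by move: jn; rewrite mem_index_iota => /andP[].
have h1 : 1 <= E `^ 2^-1 by rewrite -[leLHS](powRr0 E) ler_powR ?invr_ge0.
have i1 : i.+1%:R <= 2 * E by rewrite -addn1 natrD; lra.
have n1 : n.+1%:R <= 2 * E `^ 2^-1 by rewrite -addn1 natrD; lra.
have e1 : 0 <= 2 * E by lra.
have e2 : 0 <= 2 * E `^ 2^-1 by lra.
apply: (@le_trans _ _ ((2 * E) `^ (5 / 4) * (2 * E `^ 2^-1) `^ (5 / 4))).
  by rewrite ler_pM ?powR_ge0// ge0_ler_powR ?nnegrE.
rewrite -powRM//.
have -> : 2 * E * (2 * E `^ 2^-1) = 4 * E `^ (3 / 2).
  have -> : 3 / 2 = 1 + 2^-1 :> R by lra.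
  rewrite powRD ?powRr1//; first ring.
  by apply/implyP => _; rewrite gt_eqF//; lra.
rewrite powRM ?powR_ge0// -powRrM ler_pM ?powR_ge0//.
  have -> : 16 = 4 `^ 2 :> R by rewrite powR_mulrn//; ring.
  by rewrite ler_powR//; lra.
by rewrite ler_powR//; lra.
Qed.

End column_weights.

(** * Square integrals of orthonormal sums *)

Lemma sqr_sum_le (R : realFieldType) (I : Type) (s : seq I) (a : I -> R) :
  (\sum_(i <- s) a i) ^+ 2 <= (size s)%:R * \sum_(i <- s) a i ^+ 2.
Proof.
(* sum of 2 * t * a i <= t ^ 2 + a i ^ 2, to be used with t the mean of the a i *)
have cross t : 2 * t * (\sum_(i <- s) a i) <=
    (size s)%:R * t ^+ 2 + \sum_(i <- s) a i ^+ 2.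
  elim: s => [|i s IHs]; first by rewrite !big_nil mulr0 mul0r addr0.
  rewrite !big_cons /= mulrSr; have := sqr_ge0 (t - a i); nra.
case: (posnP (size s)) => [/size0nil->|s0].
  by rewrite !big_nil expr0n/= mulr0.
have n0 : 0 < (size s)%:R :> R by rewrite ltr0n.
set n := (size s)%:R in cross n0 *.
have := cross ((\sum_(i <- s) a i) / n).
rewrite -(ler_pM2l n0) => h.
suff : n * (2 * ((\sum_(i <- s) a i) / n) * \sum_(i <- s) a i) -
   n * (n * ((\sum_(i <- s) a i) / n) ^+ 2) = (\sum_(i <- s) a i) ^+ 2 by lra.
by field; rewrite gt_eqF.
Qed.

Section orthonormal.
Context d (T : measurableType d) (R : realType) (mu : {measure set T -> \bar R}).

(** By monotone convergence the sum of the whole series is integrable, hence finite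
    almost everywhere. *)
Lemma ae_bounded_sqsum (Phi : nat -> nat -> T -> R) (M : nat -> nat -> R) (C : R) :
  (forall i n, measurable_fun setT (Phi i n)) ->
  (forall i n x, 0 <= Phi i n x) ->
  (forall i n, (\int[mu]_(x in setT) (Phi i n x)%:E <= (M i n)%:E)%E) ->
  (forall L, sqsum M L <= C) ->
  {ae mu, forall x, exists C', forall L, sqsum (fun i n => Phi i n x) L <= C'}.
Proof.
move=> mP P0 PM MC.
pose g L x : \bar R := (sqsum (fun i n => Phi i n x) L)%:E.
have mg L : measurable_fun setT (g L).
  apply/measurable_EFinP; rewrite /sqsum.
  by apply: measurable_sum => i; apply: measurable_sum => n; exact: mP.
have g0 L x : setT x -> (0 <= g L x)%E.
  by move=> _; rewrite lee_fin; do 2 (apply: sumr_ge0 => ? _).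
have ndg x : setT x -> {homo g^~ x : n m / (n <= m)%N >-> (n <= m)%E}.
  by move=> _ n m nm; rewrite lee_fin; apply: sqsum_nondecreasing.
have intg L : (\int[mu]_(x in setT) g L x <= C%:E)%E.
  apply: (@le_trans _ _ (sqsum M L)%:E); last by rewrite lee_fin.
  rewrite /g /sqsum.
  under eq_integral do rewrite -sumEFin.
  rewrite ge0_integral_sum//; last 2 first.
  - move=> i; apply/measurable_EFinP; apply: measurable_sum => n; exact: mP.
  - by move=> i x _; rewrite lee_fin; apply: sumr_ge0.
  rewrite -sumEFin; apply: lee_sum => i _.
  under eq_integral do rewrite -sumEFin.
  rewrite ge0_integral_sum//; last 2 first.
  - by move=> n; apply/measurable_EFinP; exact: mP.
  - by move=> n x _; rewrite lee_fin.
  by rewrite -sumEFin; apply: lee_sum => n _; exact: PM.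
have cvg_int := cvg_monotone_convergence (mu := mu) measurableT mg g0 ndg.
pose G x : \bar R := limn (g^~ x).
have cvgg x : cvgn (g^~ x) by apply: ereal_nondecreasing_is_cvgn; exact: ndg.
have gG x L : (g L x <= G x)%E.
  rewrite /G (cvg_lim _ (ereal_nondecreasing_cvgn (ndg x I)))//.
  by apply: ereal_sup_ubound; exists L.
have G0 x : (0 <= G x)%E by apply: le_trans (gG x 0); exact: g0.
have intG : (\int[mu]_(x in setT) G x <= C%:E)%E.
  rewrite -(cvg_lim _ cvg_int)//; apply: lime_le; first exact: (cvgP _ cvg_int).
  by apply: nearW.
have mG : measurable_fun setT G.
  by apply: (emeasurable_fun_cvg g) => // x _; exact: cvgg.
have iG : mu.-integrable setT G.
  apply/integrableP; split => //.
  under eq_integral do rewrite gee0_abs//.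
  exact: le_lt_trans intG (ltry _).
apply: filterS (integrable_ae measurableT iG) => x /(_ I) Gx.
exists (fine (G x)) => L.
by rewrite -lee_fin fineK//; exact: gG.
Qed.

Context (I : eqType) (f : I -> T -> R)
  (mf : forall p, measurable_fun setT (f p))
  (orth_f : forall p q,
    (\int[mu]_(x in setT) (f p x * f q x)%:E = if p == q then 1 else 0)%E).

(** A vanishing integral does not give integrability by itself; it comes from the
    squares, by |f p * f q| <= f p ^ 2 + f q ^ 2. *)
Lemma orthonormal_integrable p q :
  mu.-integrable setT (fun x => (f p x * f q x)%:E).
Proof.
have sqr_int r : mu.-integrable setT (fun x => (f r x * f r x)%:E).
  apply/integrableP; split.
    by apply/measurable_EFinP; apply: measurable_funM.
  under eq_integral => x _.
    rewrite gee0_abs ?lee_fin -?expr2 ?sqr_ge0//. over.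
  by have := orth_f r r; rewrite eqxx => ->; exact: ltry.
apply: (@le_integrable _ _ _ _ _ measurableT _
  (fun x => (f p x * f p x)%:E + (f q x * f q x)%:E)%E).
- by apply/measurable_EFinP; apply: measurable_funM.
- move=> x _; rewrite -EFinD !abse_EFin lee_fin.
  rewrite (@ger0_norm _ (_ + _)) ?addr_ge0 -?expr2 ?sqr_ge0//.
  rewrite normrM -(real_normK (num_real (f p x))) -(real_normK (num_real (f q x))).
  have := sqr_ge0 (`|f p x| - `|f q x|).
  have := mulr_ge0 (normr_ge0 (f p x)) (normr_ge0 (f q x)); nra.
- exact: integrableD.
Qed.

Lemma orthonormal_integral_sqr_sum (c : I -> R) (s : seq I) : uniq s ->
  (\int[mu]_(x in setT) ((\sum_(p <- s) c p * f p x) ^+ 2)%:E =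
   (\sum_(p <- s) c p ^+ 2)%:E)%E.
Proof.
move=> us.
have E x : ((\sum_(p <- s) c p * f p x) ^+ 2)%:E =
    (\sum_(p <- s) \sum_(q <- s) (c p * c q)%:E * (f p x * f q x)%:E)%E.
  rewrite expr2 mulr_suml -sumEFin; apply: eq_bigr => p _.
  rewrite mulr_sumr -sumEFin; apply: eq_bigr => q _.
  by rewrite -EFinM mulrACA.
under eq_integral do rewrite E.
rewrite integral_sum//; last first.
  move=> p; apply: integrable_sum => // q _.
  by apply: integrableZl => //; exact: orthonormal_integrable.
rewrite -sumEFin [LHS]big_seq [RHS]big_seq; apply: eq_bigr => p ps.
rewrite integral_sum//; last first.
  by move=> q; apply: integrableZl => //; exact: orthonormal_integrable.
rewrite (bigD1_seq p)//= big1 ?adde0.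
  rewrite integralZl//; last exact: orthonormal_integrable.
  by rewrite orth_f eqxx mule1.
move=> q /negPf qp; rewrite integralZl//; last exact: orthonormal_integrable.
by rewrite orth_f eq_sym qp mule0.
Qed.

Lemma orthonormal_integral_sqr_abs_sum (c : I -> R) (s : seq I) :
  (\int[mu]_(x in setT) ((\sum_(p <- s) `|c p * f p x|) ^+ 2)%:E <=
   ((size s)%:R * \sum_(p <- s) c p ^+ 2)%:E)%E.
Proof.
have mcf p : measurable_fun setT (fun x => c p * f p x).
  by apply: measurable_funM => //; exact: measurable_cst.
apply: (@le_trans _ _ (\int[mu]_(x in setT)
    ((size s)%:R%:E * \sum_(p <- s) ((c p * f p x) ^+ 2)%:E))%E).
  apply: ge0_le_integral => //.
  - by move=> x _; rewrite lee_fin sqr_ge0.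
  - apply/measurable_EFinP; apply: measurable_funX.
    by apply: measurable_sum => p; apply: measurableT_comp.
  - apply: emeasurable_funM => //; apply: emeasurable_sum => p.
    by apply/measurable_EFinP; apply: measurable_funX.
  - move=> x _; rewrite sumEFin -EFinM lee_fin.
    apply: (le_trans (sqr_sum_le _ _)); rewrite ler_wpM2l//.
    by apply: ler_sum => p _; rewrite real_normK// num_real.
rewrite ge0_integralZl//; last 2 first.
- apply: emeasurable_sum => p; by apply/measurable_EFinP; apply: measurable_funX.
- by move=> x _; apply: sume_ge0 => p _; rewrite lee_fin sqr_ge0.
rewrite ge0_integral_sum//; last 2 first.
- by move=> p; apply/measurable_EFinP; apply: measurable_funX.
- by move=> p x _; rewrite lee_fin sqr_ge0.
rewrite EFinM -sumEFin lee_wpmul2l//; apply: lee_sum => p _.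
have := orthonormal_integral_sqr_sum c (isT : uniq [:: p]).
under eq_integral do rewrite big_seq1.
by rewrite big_seq1 => ->.
Qed.

End orthonormal.

(** * Almost everywhere convergence *)

Lemma esum_bounds_sqsum (R : realType) (g : nat * nat -> R) :
  (\esum_(p in [set: nat * nat]) (g p)%:E < +oo)%E -> (forall p, 0 <= g p) ->
  exists S, forall L,
    sqsum (fun i n => \sum_(j <- square_block n) g (i, j)) L <= S.
Proof.
move=> gfin g0; exists (fine (\esum_(p in [set: nat * nat]) (g p)%:E)) => L.
rewrite -lee_fin fineK; last first.
  by rewrite ge0_fin_numE// esum_ge0// => p _; rewrite lee_fin.
have fin : finite_set [set` square_cells L] by exact: finite_seq.
apply: esum_ge; exists [set` square_cells L]; first by split.
by rewrite -fsbig_square_cells fsumEFin.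
Qed.

(** The norm of the origin is 0, so the hypothesis says nothing about c (0, 0); this
    coefficient is accounted for by the separate family [g1]. *)
Lemma coefficient_cells_bounded (R : realType) (c : nat * nat -> R) (theta : R) :
  15 / 8 <= theta ->
  (\esum_(p in [set: nat * nat])
     (Enorm R p `^ theta * `|c p| ^+ 2)%:E < +oo)%E ->
  exists S, forall L, sqsum (fun i n =>
    cell_weight i n * \sum_(j <- square_block n) c (i, j) ^+ 2) L <= S.
Proof.
move=> th cfin.
pose g0 p : R := Enorm R p `^ theta * `|c p| ^+ 2.
pose g1 p : R := if p \in [set (0, 0)%N] then c (0, 0)%N ^+ 2 else 0.
have g00 p : 0 <= g0 p by rewrite mulr_ge0 ?powR_ge0 ?exprn_ge0.
have g10 p : 0 <= g1 p by rewrite /g1; case: ifP; rewrite ?sqr_ge0.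
have [S0 hS0] := esum_bounds_sqsum cfin g00.
have [|S1 hS1] := esum_bounds_sqsum _ g10.
  under eq_esum do rewrite /g1 (fun_if EFin).
  rewrite -(esum_mkcond [set (0, 0)%N] (fun=> (c (0, 0)%N ^+ 2)%:E)).
  by rewrite esum_set1 ?ltry// lee_fin sqr_ge0.
exists (16 * S0 + S1) => L.
apply: (@le_trans _ _ (16 * sqsum (fun i n => \sum_(j <- square_block n) g0 (i, j)) L
   + sqsum (fun i n => \sum_(j <- square_block n) g1 (i, j)) L)); last first.
  by rewrite lerD// ler_pM2l.
rewrite /sqsum mulr_sumr -big_split/=; apply: ler_sum => i _.
rewrite mulr_sumr -big_split/=; apply: ler_sum => n _.
rewrite !mulr_sumr -big_split/= big_seq [leRHS]big_seq.
apply: ler_sum => j jn; rewrite /g0 /g1 real_normK ?num_real//.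
have [ij0|ij0] := eqVneq (i, j) (0, 0)%N.
  move: jn; rewrite ij0; case: ij0 => -> ->.
  rewrite mem_set// mem_index_iota; case: n => [_|n]; last first.
    by rewrite leqn0 expn_eq0.
  rewrite -[leLHS]add0r /cell_weight /column_weight powR1 !mul1r lerD2r.
  by rewrite mulr_ge0// mulr_ge0 ?powR_ge0 ?sqr_ge0.
rewrite memNset/=; last exact/eqP.
by rewrite addr0 mulrA ler_wpM2r ?sqr_ge0// cell_weight_le.
Qed.

(** The exponent 15/8 is 5/4 for the column index plus half of 5/4 for the index in
    the column, as the latter is of the order of n ^ 2 in the cell (i, n). *)
Lemma ae_cvg_planar_grouping d (T : measurableType d) (R : realType)
    (mu : {measure set T -> \bar R}) (f : nat * nat -> T -> R)
    (c : nat * nat -> R) (theta : R) (D : nat -> set (nat * nat)) :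
  (forall p, measurable_fun setT (f p)) ->
  (forall p q, (\int[mu]_(x in setT) (f p x * f q x)%:E =
                if p == q then 1 else 0)%E) ->
  15 / 8 <= theta ->
  (\esum_(p in [set: nat * nat])
     (Enorm R p `^ theta * `|c p| ^+ 2)%:E < +oo)%E ->
  (forall k i j j', (j' <= j)%N -> D k (i, j) -> D k (i, j')) ->
  (forall k, exists L, forall i j, D k (i, j) -> (i < L)%N /\ (j < L)%N) ->
  (forall p, (\forall k \near \oo, D k p) \/ (\forall k \near \oo, ~ D k p)) ->
  {ae mu, forall x, cvgn (fun k => \sum_(p \in D k) c p * f p x)}.
Proof.
move=> mf orth_f th cfin dn bd gr.
have [S hS] := coefficient_cells_bounded th cfin.
have mcf p : measurable_fun setT (fun x => c p * f p x).
  by apply: measurable_funM => //; exact: measurable_cst.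
pose Delta i n x := \sum_(j <- square_block n) c (i, j) * f (i, j) x.
pose B i n x := \sum_(j <- square_block n) `|c (i, j) * f (i, j) x|.
pose w i n : R := cell_weight i n.
pose u i : R := column_weight i.
have u0 i : 0 < u i := column_weight_gt0 i.
have w0 i n : 0 < w i n by rewrite mulr_gt0 ?u0.
(* the two terms of [Phi] feed the two series of [cvg_planar_grouping] *)
pose Phi i n x := w i n * Delta i n x ^+ 2 + u i * B i n x ^+ 2.
(* 3 = 1 + 2, from the squares of [Delta] and [B] respectively *)
pose M i n := 3 * (w i n * \sum_(j <- square_block n) c (i, j) ^+ 2).
have P10 i n x : 0 <= w i n * Delta i n x ^+ 2.
  by rewrite mulr_ge0 ?sqr_ge0 ?ltW.
have P20 i n x : 0 <= u i * B i n x ^+ 2 by rewrite mulr_ge0 ?sqr_ge0 ?ltW.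
have mP1 i n : measurable_fun setT (fun x => w i n * Delta i n x ^+ 2).
  apply: measurable_funM; first exact: measurable_cst.
  by apply: measurable_funX; apply: measurable_sum => j; exact: mcf.
have mP2 i n : measurable_fun setT (fun x => u i * B i n x ^+ 2).
  apply: measurable_funM; first exact: measurable_cst.
  apply: measurable_funX; apply: measurable_sum => j.
  by apply: measurableT_comp => //; exact: mcf.
pose s i n : seq (nat * nat) := [seq (i, j) | j <- square_block n].
have us i n : uniq (s i n) by rewrite map_inj_uniq ?iota_uniq// => ? ? [].
have intP i n : (\int[mu]_(x in setT) (Phi i n x)%:E <= (M i n)%:E)%E.
  under eq_integral do rewrite EFinD.
  rewrite ge0_integralD//; last 4 first.
  - by move=> x _; rewrite lee_fin.
  - exact/measurable_EFinP.
  - by move=> x _; rewrite lee_fin.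
  - exact/measurable_EFinP.
  have -> : M i n = w i n * (\sum_(p <- s i n) c p ^+ 2) +
      2 * (w i n * \sum_(p <- s i n) c p ^+ 2) by rewrite /M big_map; ring.
  rewrite EFinD; apply: leeD.
    under eq_integral do rewrite EFinM.
    rewrite ge0_integralZl//; last 3 first.
    - apply/measurable_EFinP/measurable_funX/measurable_sum => j; exact: mcf.
    - by move=> x _; rewrite lee_fin sqr_ge0.
    - by rewrite lee_fin ltW.
    rewrite [X in (_ <= X)%E]EFinM -(orthonormal_integral_sqr_sum mf orth_f)//.
    by under [X in (_ <= _ * X)%E]eq_integral do rewrite big_map.
  under eq_integral do rewrite EFinM.
  rewrite ge0_integralZl//; last 3 first.
  - apply/measurable_EFinP/measurable_funX/measurable_sum => j.
    by apply: measurableT_comp => //; exact: mcf.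
  - by move=> x _; rewrite lee_fin sqr_ge0.
  - by rewrite lee_fin ltW.
  have := orthonormal_integral_sqr_abs_sum mf orth_f c (s i n).
  under eq_integral do rewrite big_map.
  move=> h; apply: (@le_trans _ _ ((u i)%:E *
     ((size (s i n))%:R * \sum_(p <- s i n) c p ^+ 2)%:E)%E).
    by rewrite lee_wpmul2l// lee_fin ltW.
  rewrite -EFinM lee_fin.
  set Q := \sum_(p <- _) _.
  have Q0 : 0 <= Q by apply: sumr_ge0 => p _; rewrite sqr_ge0.
  have sz : (size (s i n))%:R <= 2 * u n.
    apply: (@le_trans _ _ (2 * n.+1%:R)); last first.
      by rewrite ler_pM2l// column_weight_ge.
    rewrite size_map size_iota -natrM ler_nat.
    by rewrite leq_subLR -!mulnn; lia.
  have -> : 2 * (w i n * Q) = u i * (2 * u n * Q).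
    by rewrite /w /cell_weight -/(u i) -/(u n); ring.
  by rewrite ler_pM2l// ler_wpM2r.
have MS L : sqsum M L <= 3 * S.
  apply: le_trans (_ : 3 * sqsum (fun i n =>
    w i n * \sum_(j <- square_block n) c (i, j) ^+ 2) L <= _).
    rewrite /sqsum mulr_sumr; apply: ler_sum => i _.
    by rewrite mulr_sumr.
  by rewrite ler_pM2l//; exact: hS.
have := ae_bounded_sqsum (fun i n => measurable_funD (mP1 i n) (mP2 i n))
  (fun i n x => addr_ge0 (P10 i n x) (P20 i n x)) intP MS.
apply: filterS => x [C HC].
apply: (cvg_planar_grouping (u := u) (U := 5) (C1 := 25 + C) (C2 := C)) => //.
- exact: sum_inv_column_weight.
- move=> L; apply: (@le_trans _ _ (sqsum (fun i n => (u i)^-1 * (u n)^-1) L +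
     sqsum (fun i n => Phi i n x) L)).
    rewrite /sqsum -big_split/=; apply: ler_sum => i _.
    rewrite -big_split/=; apply: ler_sum => n _.
    rewrite -/(Delta i n x) -invfM -/(cell_weight i n) -/(w i n).
    apply: (@le_trans _ _ ((w i n)^-1 + w i n * Delta i n x ^+ 2)).
      rewrite -(ler_pM2l (w0 i n)) mulrDr divff ?gt_eqF//.
      rewrite -(real_normK (num_real (Delta i n x))).
      have := sqr_ge0 (w i n * `|Delta i n x| - 1).
      have := sqr_ge0 (w i n * `|Delta i n x|); nra.
    by rewrite lerD2l lerDl.
  rewrite lerD// /sqsum.
  under eq_bigr do rewrite -mulr_sumr.
  rewrite -mulr_suml.
  have := sum_inv_column_weight (R := R) L.
  have : 0 <= \sum_(0 <= i < L) (u i)^-1.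
    by apply: sumr_ge0 => i _; rewrite invr_ge0 ltW.
  rewrite /u; nra.
- move=> L; apply: le_trans (HC L); apply: ler_sqsum => i n.
  by rewrite lerDr.
Qed.

Lemma Tri_index_down (R : realType) (a b : R) i j j' : 0 < b -> (j' <= j)%N ->
  Tri_index a b (i, j) -> Tri_index a b (i, j').
Proof.
move=> b0 jj [s [t [s0 t0 st [ia jb]]]].
exists s, (j'%:R / b); split => //=.
- by rewrite divr_ge0// ltW.
- rewrite (le_trans _ st)// lerD2l ler_pdivrMr// -jb ler_nat//.
- by rewrite ia divfK ?gt_eqF.
Qed.

Lemma Tri_index_bounded (R : realType) (a b : R) : 0 < a -> 0 < b ->
  exists L, forall i j, Tri_index a b (i, j) -> (i < L)%N /\ (j < L)%N.
Proof.
move=> a0 b0; exists (maxn (Num.bound a) (Num.bound b)) => i j.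
move=> [s [t [s0 t0 st [ia jb]]]]; rewrite !leq_max; split; apply/orP.
  left; rewrite -(ltr_nat R); apply: le_lt_trans (archi_boundP (ltW a0)).
  by rewrite ia ger_pMl//; lra.
right; rewrite -(ltr_nat R); apply: le_lt_trans (archi_boundP (ltW b0)).
by rewrite jb ger_pMl//; lra.
Qed.

Unset Implicit Arguments.
Set Strict Implicit.

Theorem theorem1p9 (R : realType) (X : pmetricType R)
    (mu : {measure set (borel X) -> \bar R}) (hmu : radon mu)
    (f : nat * nat -> borel X -> R) (hf : orthonormal_system mu f)
    (c : nat * nat -> R)
    (hc : (\esum_(p in [set: nat * nat])
             (Enorm R p `^ (ln (2 + Num.sqrt 3) / ln 2) * `|c p| ^+ 2)%:E
           < +oo)%E)
    (a b : nat -> R) (ha : forall k, 0 < a k) (hb : forall k, 0 < b k)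
    (hab : grouping a b)
    (gamma : R) (hgamma1 : 1 <= gamma) (hgamma : eccentricity a b = gamma%:E) :
  {ae mu, forall x, cvgn (fun k => Tri_sum c f (a k) (b k) x)}.
Proof.
have [mf orth_f] := hf.
apply: (ae_cvg_planar_grouping mf orth_f exponent_ge hc) => //.
- by move=> k i j j'; exact: Tri_index_down.
- by move=> k; exact: Tri_index_bounded.
Qed.
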